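(* Let $\mathcal{G}$ be the infinite two-dimensional hexagonal grid (honeycomb) whose edges all have length $l>0$. For every $u\in W^{1,1}(\mathcal{G})$, $$\|u\|_{L^2(\mathcal{G})}\leq 2\sqrt{2l}\,\|u'\|_{L^1(\mathcal{G})}.$$
   Context: The honeycomb $\mathcal{G}$ is the metric graph given by the vertices and edges of the tiling of the plane $\mathbb{R}^2$ by identical regular hexagons of side length $l>0$. Equivalently: its vertices are $a_{m,n}, b_{m,n}$ with $(m,n)\in\mathbb{Z}^2$, and each $a_{m,n}$ is joined by exactly one edge to each of $b_{m,n}$, $b_{m-1,n}$, $b_{m,n-1}$ (and there are no other edges). Every edge is identified with the interval $[0,l]$ through an arclength coordinate. A (complex-valued) function $u$ on $\mathcal{G}$ is a family of functions $u_e:[0,l]\to\mathbb{C}$, one for each edge $e$; norms on $\mathcal{G}$ are obtained by summing over edges: $\|u\|_{L^q(\mathcal{G})}=\left(\sum_e\int_0^l|u_e|^q\,dx\right)^{1/q}$; $u'$ is the edgewise weak derivative. $W^{1,1}(\mathcal{G})$ is the space of functions $u$ that are continuous on $\mathcal{G}$ (in particular at vertices) with $u,u'\in L^1(\mathcal{G})$. *)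

(* Defs.v *)
From mathcomp Require Import all_boot all_order all_algebra.
From mathcomp Require Import all_classical all_reals all_analysis.
From mathcomp Require Import complex.

Set Implicit Arguments.
Unset Strict Implicit.
Unset Printing Implicit Defensive.

Import Order.TTheory GRing.Theory Num.Theory.
Import numFieldNormedType.Exports.

Local Open Scope classical_set_scope.
Local Open Scope ring_scope.

(* [inl (m, n)] is the vertex a_{m,n} and [inr (m, n)] the vertex b_{m,n}. *)
Definition vertex : Type := (int * int + int * int)%type.

(* For k = 0, 1, 2, the edge ((m, n), k) joins a_{m,n} to b_{m,n}, b_{m-1,n},
   b_{m,n-1} respectively.  Its arclength coordinate is 0 at the a-vertex and l
   at the b-vertex. *)
Definition edge : Type := (int * int * 'I_3)%type.

Definition a_end (e : edge) : vertex := inl e.1.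

Definition b_end (e : edge) : vertex :=
  let: (m, n, k) := e in
  match val k with
  | 0%N => inr (m, n)
  | 1%N => inr (m - 1, n)
  | _ => inr (m, n - 1)
  end.

(* The edge component [u e] is a total function on R; only its values on [0, l]
   are used below. *)
Definition gfun (R : realType) : Type := edge -> R -> R[i].

Definition re (R : realType) (f : R -> R[i]) (x : R) : R := complex.Re (f x).
Definition im (R : realType) (f : R -> R[i]) (x : R) : R := complex.Im (f x).

Definition continuousG (R : realType) (l : R) (u : gfun R) : Prop :=
  (forall e, {within `[0, l], continuous (re (u e))} /\
             {within `[0, l], continuous (im (u e))}) /\
  exists w : vertex -> R[i],
    forall e, u e 0 = w (a_end e) /\ u e l = w (b_end e).

Definition normG (R : realType) (l q : R) (u : gfun R) : \bar R :=
  ((\esum_(e in [set: edge])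
     \int[@lebesgue_measure R]_(x in `[0%R, l])
       (ComplexField.Normc.normc (u e x) `^ q)%:E) `^ q^-1)%E.

Definition memLqG (R : realType) (l q : R) (u : gfun R) : Prop :=
  (forall e, measurable_fun `[0, l] (re (u e)) /\
             measurable_fun `[0, l] (im (u e))) /\
  (normG l q u < +oo)%E.

Definition test_function (R : realType) (l : R) (phi : R -> R) : Prop :=
  (forall (n : nat) (x : R), derivable (derive1n n phi) x 1) /\
  compact (closure [set x | phi x != 0]) /\
  closure [set x | phi x != 0] `<=` `]0, l[.

Definition weak_derivative (R : realType) (l : R) (f g : R -> R) : Prop :=
  locally_integrable `]0, l[ f /\ locally_integrable `]0, l[ g /\
  forall phi : R -> R, test_function l phi ->
    \int[@lebesgue_measure R]_(x in `]0, l[) (f x * derive1 phi x) =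
    - \int[@lebesgue_measure R]_(x in `]0, l[) (g x * phi x).

(* Since test functions are real-valued, a complex weak derivative amounts to
   weak derivatives of the real and imaginary parts. *)
Definition weak_derivativeG (R : realType) (l : R) (u v : gfun R) : Prop :=
  forall e, weak_derivative l (re (u e)) (re (v e)) /\
            weak_derivative l (im (u e)) (im (v e)).

Definition W11G (R : realType) (l : R) (u : gfun R) : Prop :=
  continuousG l u /\ memLqG l 1 u /\
  exists v : gfun R, weak_derivativeG l u v /\ memLqG l 1 v.

(* Main.v *)
Require Import Defs.
From mathcomp Require Import all_boot all_order all_algebra.
From mathcomp Require Import all_classical all_reals all_analysis.
From mathcomp Require Import complex measurable_realfun ring lra zify.

(* The edges of any two of the three types form a family of parallel infinite
   zigzags.  Since u is integrable it gets arbitrarily small along a zigzag, so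
   at a point of a zigzag the real and imaginary parts of u are bounded by the
   L^1 norm of u' on that zigzag.  An edge lies on exactly two zigzags, P and Q,
   and is determined by them and its type; hence |u|^2 <= 2 |u'|_P |u'|_Q on that
   edge, and summing over the edges of one type, as for the Loomis-Whitney
   inequality, gives 2 l |u'|^2.  The three types together give 6 l |u'|^2, which
   is below 8 l |u'|^2. *)

Set Implicit Arguments.
Unset Strict Implicit.
Unset Printing Implicit Defensive.

Import Order.TTheory GRing.Theory Num.Theory.
Import numFieldNormedType.Exports.

Local Open Scope classical_set_scope.
Local Open Scope ring_scope.

(** * Smooth step functions *)

Section smooth_step.
Context {R : realType}.
Implicit Types (f : R -> R) (n : nat) (x : R).

(** The function [x^-n exp(-1/x)], extended by 0 to [x <= 0]. The power [n] is carried along because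
    differentiating lands in the span of the same family. *)
Definition flat n x : R := if 0 < x then x^-1 ^+ n * expR (- x^-1) else 0.

Lemma flat_ge0 n x : 0 <= flat n x.
Proof.
rewrite /flat; case: ifP => // x0.
by rewrite mulr_ge0 ?expR_ge0// exprn_ge0// invr_ge0 ltW.
Qed.

Lemma flat_gt0 n x : 0 < x -> 0 < flat n x.
Proof.
by move=> x0; rewrite /flat x0 mulr_gt0 ?expR_gt0// exprn_gt0// invr_gt0.
Qed.

Lemma flat_npos n x : x <= 0 -> flat n x = 0.
Proof. by rewrite /flat leNgt; case: ifP. Qed.

(** With [y = 1/x], the exponential series gives [y^(n+2) <= (n+2)! exp y]. A bound of order 2 is
    what makes the derivative at 0 exist and vanish. *)
Lemma flat_quadratic n x : flat n x <= (n.+2)`!%:R * x ^+ 2.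
Proof.
have [x0|x0] := leP x 0; first by rewrite flat_npos// mulr_ge0// sqr_ge0.
rewrite /flat x0 expRN.
have y0 : 0 < x^-1 by rewrite invr_gt0.
have fact0 : 0 < (n.+2)`!%:R :> R by rewrite ltr0n fact_gt0.
have : x^-1 ^+ n.+2 <= (n.+2)`!%:R * expR x^-1.
  rewrite mulrC -ler_pdivrMr//.
  by apply: le_trans (expR_ge1Dxn n.+1 (ltW y0)); rewrite lerDr.
rewrite -[x^-1 ^+ n.+2]/(x^-1 ^+ (2 + n)) exprD => le_exp.
rewrite ler_pdivrMr ?expR_gt0// -mulrA [_ ^+ 2 * _]mulrC mulrA.
by rewrite -ler_pdivrMr ?exprn_gt0// mulrC -exprVn.
Qed.

Lemma is_derive_flat n x :
  is_derive x 1 (flat n) (flat n.+2 x - n%:R * flat n.+1 x).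
Proof.
have [x0|x0|->] := ltgtP x 0.
- rewrite !flat_npos ?(ltW x0)// mulr0 subrr.
  apply: (near_eq_is_derive (f := cst 0)).
  near=> z; rewrite flat_npos// ltW//; near: z; exact: lt_nbhsl.
- apply: (near_eq_is_derive
    (f := ((fun z => z^-1) ^+ n) * (expR \o (fun z => - z^-1)))).
    near=> z; rewrite /flat ifT ?fctE//; near: z; exact: lt_nbhsr.
  have xN0 : x != 0 by rewrite gt_eqF.
  have dinv : is_derive x (1 : R) (fun z => z^-1) (- x ^- 2).
    have := is_deriveV (f := id) xN0 (is_derive_id x (1 : R)).
    by rewrite [_ *: _]mulr1.
  have dexp : is_derive x 1 (expR \o (fun z => - z^-1))
      (expR (- x^-1) * - - x ^- 2).
    apply: is_derive1_comp.
  have dpow := is_deriveX n dinv.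
  have := is_deriveM dpow dexp.
  move=> /is_derive_eq; apply.
  rewrite /flat x0 exprfctE /GRing.scale/= !mulrA.
  case: n dpow => [|n] _ /=; first by rewrite !expr0; field.
  by rewrite !exprS; field.
- rewrite !flat_npos// mulr0 subrr.
  (* At 0 the difference quotient is [flat n h / h], of absolute value at most [(n+2)! |h|] by the
     quadratic bound. *)
  have lim0 : h^-1 *: (flat n (h *: (1 : R) + 0) - flat n 0) @[h --> 0^']
      --> (0 : R).
    apply/cvgr0Pnorm_le => e e0.
    have fact0 : 0 < (n.+2)`!%:R :> R by rewrite ltr0n fact_gt0.
    near=> h.
    have hN0 : h != 0 by near: h; exact: nbhs_dnbhs_neq.
    rewrite addr0 [flat n 0]flat_npos// subr0 /GRing.scale/= mulr1.
    rewrite normrM normfV.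
    rewrite (ger0_norm (flat_ge0 n h)) mulrC ler_pdivrMr ?normr_gt0//.
    rewrite (le_trans (flat_quadratic n h))// -real_normK ?num_real//.
    rewrite expr2 mulrA.
    rewrite ler_wpM2r// mulrC -ler_pdivlMr//.
    near: h; apply: dnbhs0_le; by rewrite divr_gt0.
  split; first by apply/cvg_ex; exists 0.
  exact/cvg_lim.
Unshelve. all: by end_near. Qed.

(* Closed under differentiation, whence all derivatives exist. *)
Inductive smooth_expr : (R -> R) -> Prop :=
| smooth_flat n a b : smooth_expr (fun x => flat n (a * x + b))
| smooth_cst c : smooth_expr (fun=> c)
| smooth_add f g : smooth_expr f -> smooth_expr g ->
    smooth_expr (fun x => f x + g x)
| smooth_mul f g : smooth_expr f -> smooth_expr g ->
    smooth_expr (fun x => f x * g x)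
| smooth_inv f : (forall x, f x != 0) -> smooth_expr f ->
    smooth_expr (fun x => (f x)^-1).

Lemma smooth_opp f : smooth_expr f -> smooth_expr (fun x => - f x).
Proof.
move=> sf; rewrite (_ : (fun x => _) = (fun x => -1 * f x)).
  by apply: smooth_mul => //; exact: smooth_cst.
by apply/funext => x; rewrite mulN1r.
Qed.

Lemma smooth_expr_derive f : smooth_expr f ->
  exists2 df, smooth_expr df & forall x, is_derive x 1 f (df x).
Proof.
elim=> [n a b|c|{}f g _ [df sdf Hf] _ [dg sdg Hg]
  |{}f g sf [df sdf Hf] sg [dg sdg Hg]|{}f f0 sf [df sdf Hf]].
- exists (fun x => (flat n.+2 (a * x + b) - n%:R * flat n.+1 (a * x + b)) * a).
    apply: smooth_mul; last exact: smooth_cst.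
    apply: smooth_add; first exact: smooth_flat.
    apply/smooth_opp/smooth_mul; [exact: smooth_cst|exact: smooth_flat].
  move=> x.
  have daff : is_derive x 1 (fun z => a * z + b) a.
    have := is_deriveD (is_deriveZ a (is_derive_id x (1 : R)))
      (is_derive_cst b x (1 : R)).
    by rewrite addr0 [_ *: _]mulr1.
  exact: (is_derive1_comp (g := fun z => a * z + b) (is_derive_flat n _) daff).
- by exists (fun=> 0); [exact: smooth_cst|move=> x; exact: is_derive_cst].
- exists (fun x => df x + dg x); first exact: smooth_add.
  by move=> x; exact: is_deriveD.
- exists (fun x => f x * dg x + g x * df x).
    by apply: smooth_add; exact: smooth_mul.
  by move=> x; exact: is_deriveM.
- exists (fun x => - ((f x)^-1 * (f x)^-1) * df x).
    by apply: smooth_mul => //; apply/smooth_opp/smooth_mul; exact: smooth_inv.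
  move=> x; have := is_deriveV (f0 x) (Hf x).
  move=> /is_derive_eq; apply.
  by rewrite /GRing.scale/= -invfM -expr2.
Qed.

Lemma smooth_expr_derive1n f n : smooth_expr f -> smooth_expr (derive1n n f).
Proof.
move=> sf; elim: n => // n /smooth_expr_derive[df sdf Hf].
rewrite derive1nS (_ : derive1 _ = df)//.
by apply/funext => x; rewrite derive1E; have [_ ->] := Hf x.
Qed.

Lemma smooth_expr_derivable f : smooth_expr f ->
  forall n x, derivable (derive1n n f) x 1.
Proof.
move=> sf n x.
by have [df _ /(_ x)[]] := smooth_expr_derive (smooth_expr_derive1n n sf).
Qed.

Lemma smooth_expr_continuous f : smooth_expr f -> continuous f.
Proof.
move=> sf x; apply/differentiable_continuous; rewrite -derivable1_diffP.
exact: smooth_expr_derivable sf 0 x.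
Qed.

(** The step is [p / (p + q)], where [p] is positive exactly to the right of [a] and [q] exactly to
    the left of [a + d]; as [0 < d], these half-lines cover the line and the denominator never
    vanishes. *)
Lemma smooth_step_exists (a d : R) : 0 < d -> exists S dS,
  [/\ smooth_expr S, smooth_expr dS, forall x, is_derive x 1 S (dS x),
    (forall x, 0 <= dS x) & (forall x, 0 <= S x <= 1)] /\
  [/\ forall x, x <= a -> S x = 0 /\ dS x = 0 &
    forall x, a + d <= x -> S x = 1 /\ dS x = 0].
Proof.
move=> d0.
pose p x := flat 0 (1 * x + - a); pose q x := flat 0 (-1 * x + (a + d)).
(* The derivative of [flat 0] is [flat 2]. Since [q] decreases, [dq] is the opposite of its
   derivative, so that the quotient rule yields only nonnegative terms. *)
pose dp x := flat 2 (1 * x + - a); pose dq x := flat 2 (-1 * x + (a + d)).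
have pq0 x : 0 < p x + q x.
  have [ax|xa] := ltP a x.
    by rewrite ltr_pwDl ?flat_ge0// flat_gt0//; lra.
  by rewrite ltr_wpDl ?flat_ge0// flat_gt0//; lra.
have pqN0 x : p x + q x != 0 by rewrite gt_eqF.
have sp : smooth_expr p by exact: smooth_flat.
have sq : smooth_expr q by exact: smooth_flat.
have sdp : smooth_expr dp by exact: smooth_flat.
have sdq : smooth_expr dq by exact: smooth_flat.
have Dp x : is_derive x 1 p (dp x).
  have daff : is_derive x 1 (fun z => 1 * z + - a) 1.
    have := is_deriveD (is_deriveZ 1 (is_derive_id x (1 : R)))
      (is_derive_cst (- a) x (1 : R)).
    by rewrite addr0 [_ *: _]mulr1.
  have := is_derive1_comp (g := fun z => 1 * z + - a) (is_derive_flat 0 _) daff.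
  by rewrite mul0r subr0 mulr1.
have Dq x : is_derive x 1 q (- dq x).
  have daff : is_derive x 1 (fun z => -1 * z + (a + d)) (-1).
    have := is_deriveD (is_deriveZ (-1) (is_derive_id x (1 : R)))
      (is_derive_cst (a + d) x (1 : R)).
    by rewrite addr0 [_ *: _]mulr1.
  have := is_derive1_comp (g := fun z => -1 * z + (a + d))
    (is_derive_flat 0 _) daff.
  by rewrite mul0r subr0 mulrN1.
exists (fun x => p x * (p x + q x)^-1).
exists (fun x => (dp x * q x + p x * dq x) * ((p x + q x)^-1 * (p x + q x)^-1)).
have sinv : smooth_expr (fun x => (p x + q x)^-1).
  by apply: smooth_inv => //; exact: smooth_add.
split; split.
- exact: smooth_mul.
- by apply: smooth_mul; [apply: smooth_add|]; exact: smooth_mul.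
- move=> x; have := is_deriveM (Dp x)
    (is_deriveV (f := p + q) (pqN0 x) (is_deriveD (Dp x) (Dq x))).
  move=> /is_derive_eq; apply.
  rewrite /GRing.scale/= -[(p + q) x]/(p x + q x); field; exact: pqN0.
- move=> x; rewrite mulr_ge0//.
    by rewrite addr_ge0// mulr_ge0// flat_ge0.
  by rewrite mulr_ge0// invr_ge0 ltW.
- move=> x; rewrite mulr_ge0 ?flat_ge0 ?invr_ge0 ?(ltW (pq0 x))//=.
  by rewrite ler_pdivrMr// mul1r lerDl flat_ge0.
- move=> x xa; have xa0 : 1 * x + - a <= 0 by lra.
  by rewrite /p /dp !(flat_npos _ xa0) !mul0r addr0 mul0r.
- move=> x xa; have xa0 : -1 * x + (a + d) <= 0 by lra.
  move: (pqN0 x).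
  by rewrite /q /dq !(flat_npos _ xa0) !mulr0 !addr0 mul0r => ?; rewrite divff.
Qed.

End smooth_step.

(** * Oscillation and weak derivatives *)

Section weak_oscillation.
Context {R : realType}.
Local Notation mu := (@lebesgue_measure R).

Lemma continuous_right_neighborhood (l p e : R) (f : R -> R) :
  {within `[0, l], continuous f} -> 0 < p < l -> 0 < e ->
  exists2 r, 0 < r & p + r < l /\
    forall t, p <= t <= p + r -> `|f p - f t| <= e.
Proof.
move=> cf /andP[p0 pl] e0.
have l0 : 0 < l by exact: lt_trans pl.
have := within_continuous_continuous l0 cf.
move=> /(_ p); rewrite in_itv/= p0 pl => /(_ isT).
move=> /cvgrPdist_le /(_ _ e0) /nbhs_ballP[r /= r0 rP].
exists (Num.min (r / 2) ((l - p) / 2)).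
  by rewrite lt_min !divr_gt0// subr_gt0.
split.
  have : Num.min (r / 2) ((l - p) / 2) <= (l - p) / 2.
    by rewrite ge_min lexx orbT.
  lra.
move=> t /andP[pt tr]; apply: rP; rewrite /ball/= ltr_distlC.
have : Num.min (r / 2) ((l - p) / 2) <= r / 2 by rewrite ge_min lexx.
by move=> ?; apply/andP; split; lra.
Qed.

Lemma integral_derivative (l : R) (F dF : R -> R) : 0 < l ->
  continuous dF -> (forall x : R, is_derive x 1 F (dF x)) ->
  \int[mu]_(x in `]0, l[) dF x = F l - F 0.
Proof.
move=> l0 cdF dF_.
have cF : continuous F.
  move=> x; apply/differentiable_continuous; rewrite -derivable1_diffP.
  by have [] := dF_ x.
rewrite /Rintegral -(@integral_itv_bndoo _ _ _ _ true false); last first.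
  apply/measurable_EFinP; apply: (measurable_funS measurableT) => //.
  exact: continuous_measurable_fun.
rewrite (@continuous_FTC2 _ dF F)//.
- exact: continuous_subspaceT.
- split.
  + by move=> x _; have [] := dF_ x.
  + exact/cvg_at_right_filter/cF.
  + exact/cvg_at_left_filter/cF.
- by move=> x _; rewrite derive1E; have [_ ->] := dF_ x.
Qed.

(* The test function is [S_y - S_x], where [S_p] is a smooth step from 0 to 1
   located just to the right of [p]; no order between x and y is needed.
   Replacing [f] by its bounds near [y] and near [x] turns [f * phi'] into the
   derivative of a combination of [S_y] and [S_x]. *)
Lemma weak_derivative_sub_le (l : R) (f g : R -> R) (x y : R) :
  {within `[0, l], continuous f} -> weak_derivative l f g ->
  0 < x < l -> 0 < y < l ->
  ((f x - f y)%:E <= \int[mu]_(t in `]0%R, l[) `|g t|%:E)%E.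
Proof.
move=> cf [_ [[mg _ _] fg]] xl yl.
have l0 : 0 < l by move: xl => /andP[/lt_trans]; apply.
have [Ioo|] := eqVneq (\int[mu]_(t in `]0%R, l[) `|g t|%:E)%E +oo%E.
  by rewrite Ioo leey.
rewrite -ltey => Ifin.
have ig : mu.-integrable `]0, l[ (EFin \o g).
  by apply/integrableP; split; first exact/measurable_EFinP.
apply/lee_addgt0Pr => e e0.
have e20 : 0 < e / 2 by rewrite divr_gt0.
have [rx rx0 [xrl fx]] := continuous_right_neighborhood cf xl e20.
have [ry ry0 [yrl fy]] := continuous_right_neighborhood cf yl e20.
have d0 : 0 < Num.min rx ry by rewrite lt_min rx0.
set d := Num.min rx ry in d0.
have dx : d <= rx by rewrite ge_min lexx.
have dy : d <= ry by rewrite ge_min lexx orbT.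
have [Sx [dSx [[sSx sdSx DSx dSx0 Sx01] [Sxl Sxr]]]] := smooth_step_exists x d0.
have [Sy [dSy [[sSy sdSy DSy dSy0 Sy01] [Syl Syr]]]] := smooth_step_exists y d0.
pose phi t := Sy t + - Sx t.
pose dphi t := dSy t + - dSx t.
have sphi : smooth_expr phi by apply: smooth_add => //; exact: smooth_opp.
have sdphi : smooth_expr dphi by apply: smooth_add => //; exact: smooth_opp.
have dphiE : derive1 phi = dphi.
  apply/funext => t; rewrite derive1E.
  by have [_ ->] := is_deriveB (DSy t) (DSx t).
(* Left of both points the two steps are 0, and beyond [Num.max x y + d] both are 1, so their
   difference has compact support. *)
have supp : closure [set t | phi t != 0] `<=` `[Num.min x y, Num.max x y + d].
  have : [set t | phi t != 0] `<=` `[Num.min x y, Num.max x y + d].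
    move=> t /= phit; rewrite in_itv/=; apply/andP.
    split; rewrite leNgt; apply/negP.
      rewrite lt_min => /andP[tx ty]; move: phit; rewrite /phi.
      by rewrite (Sxl _ (ltW tx)).1 (Syl _ (ltW ty)).1 subrr eqxx.
    rewrite -ltrBrDr gt_max => /andP[tx ty]; move: phit; rewrite /phi.
    by rewrite (Sxr t _).1 ?(Syr t _).1 ?subrr ?eqxx//; lra.
  move=> /closureS/subset_trans; apply.
  by rewrite -(closure_id _).1//; exact: itv_closed.
have testphi : test_function l phi.
  split; first exact: smooth_expr_derivable.
  split.
    exact: subclosed_compact (@closed_closure _ _)
      (@segment_compact _ _ _) supp.
  apply: subset_trans supp _ => t /=; rewrite !in_itv/= ge_min.
  move: xl yl => /andP[x0 xl] /andP[y0 yl] /andP[lt_t].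
  rewrite -lerBlDr le_max => t_lt; apply/andP; split.
    by move: lt_t => /orP[]; apply: lt_le_trans.
  by move: t_lt => /orP[]; lra.
have key := fg _ testphi; rewrite dphiE in key.
pose psi t := (f y + e / 2) * Sy t + (- (f x - e / 2)) * Sx t.
pose dpsi t := (f y + e / 2) * dSy t + (- (f x - e / 2)) * dSx t.
have sdpsi : smooth_expr dpsi.
  by apply: smooth_add; apply: smooth_mul => //; exact: smooth_cst.
have Dpsi (t : R) : is_derive t 1 psi (dpsi t).
  exact: (is_deriveD (is_deriveZ (f y + e / 2) (DSy t))
    (is_deriveZ (- (f x - e / 2)) (DSx t))).
have cdpsi := smooth_expr_continuous sdpsi.
have cdphi := smooth_expr_continuous sdphi.
have int_psi : \int[mu]_(t in `]0, l[) dpsi t = f y + e / 2 - (f x - e / 2).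
  rewrite (integral_derivative l0 cdpsi Dpsi) /psi.
  move: xl yl => /andP[x0 xl] /andP[y0 yl].
  rewrite (Sxl _ (ltW x0)).1 (Syl _ (ltW y0)).1.
  rewrite (Sxr l _).1 ?(Syr l _).1; [|lra..].
  by rewrite !mulr0 !mulr1 addr0 subr0.
have oo_cc : `]0, l[ `<=` `[0, l] by exact: subset_itv_oo_cc.
have int_fphi : mu.-integrable `]0, l[ (EFin \o (fun t => f t * dphi t)).
  suff : mu.-integrable `[0, l] (EFin \o (fun t => f t * dphi t)).
    exact: integrableS.
  apply: continuous_compact_integrable; first exact: segment_compact.
  move=> z; apply: (@continuousM _ (subspace `[0, l]) f dphi); first exact: cf.
  exact: (continuous_subspaceT cdphi).
have int_dpsi : mu.-integrable `]0, l[ (EFin \o dpsi).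
  suff : mu.-integrable `[0, l] (EFin \o dpsi) by exact: integrableS.
  apply: continuous_compact_integrable; first exact: segment_compact.
  exact: continuous_subspaceT.
(* [dSy] lives on [[y, y + d]], where [f <= f y + e / 2], and [dSx] on [[x, x + d]], where
   [f >= f x - e / 2]. Both are nonnegative, so [f * dphi <= dpsi] pointwise. *)
have upper : \int[mu]_(t in `]0, l[) (f t * dphi t) <=
    f y + e / 2 - (f x - e / 2).
  rewrite -int_psi; apply: le_Rintegral => // t _.
  rewrite /dphi /dpsi mulrDr mulrN mulNr lerB//.
  - have [ty|yt] := leP t y; first by rewrite (Syl _ ty).2 !mulr0.
    have [ty'|yt'] := leP (y + d) t; first by rewrite (Syr _ ty').2 !mulr0.
    rewrite ler_wpM2r//.
    have := fy t; rewrite (ltW yt) (le_trans (ltW yt'))/= ?lerD2l// => /(_ isT).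
    by rewrite ler_norml => /andP[]; lra.
  - have [ty|yt] := leP t x; first by rewrite (Sxl _ ty).2 !mulr0.
    have [ty'|yt'] := leP (x + d) t; first by rewrite (Sxr _ ty').2 !mulr0.
    rewrite ler_wpM2r//.
    have := fx t; rewrite (ltW yt) (le_trans (ltW yt'))/= ?lerD2l// => /(_ isT).
    by rewrite ler_norml => /andP[]; lra.
have phi1 t : `|phi t| <= 1.
  have /andP[? ?] := Sx01 t; have /andP[? ?] := Sy01 t.
  by rewrite /phi ler_norml; apply/andP; split; lra.
have mphi : measurable_fun `]0, l[ phi.
  apply: (measurable_funS measurableT) => //.
  apply: continuous_measurable_fun; exact: smooth_expr_continuous.
have int_gphi : mu.-integrable `]0, l[ (EFin \o (fun t => g t * phi t)).
  apply: le_integrable ig => //.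
    by apply/measurable_EFinP; exact: measurable_funM.
  by move=> t _ /=; rewrite lee_fin normrM ler_piMr.
have lower : \int[mu]_(t in `]0, l[) (g t * phi t) <=
    \int[mu]_(t in `]0, l[) `|g t|.
  apply: (le_trans (ler_norm _)).
  apply: (le_trans (le_normr_Rintegral _ _)) => //.
  apply: le_Rintegral => //.
  - exact: integrable_abse int_gphi.
  - exact: integrable_abse ig.
  - by move=> t _; rewrite normrM ler_piMr.
have -> : (\int[mu]_(t in `]0%R, l[) `|g t|%:E)%E =
    (\int[mu]_(t in `]0, l[) `|g t|)%:E.
  rewrite /Rintegral fineK// ge0_fin_numE//.
  by apply: integral_ge0 => t _; rewrite lee_fin.
(* By the weak derivative identity the two left-hand sides cancel, leaving 0 below [f y - f x + e]
   plus the integral of [|g|]. *)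
rewrite -EFinD lee_fin; move: (lerD upper lower); rewrite key addNr.
move: (Rintegral _ _ _) (f x) (f y) => B a b; clear; lra.
Qed.

(** The estimate by test functions reaches interior points only; this carries it to the endpoints,
    where the edges meet. *)
Lemma interior_approx (l p e : R) (f : R -> R) : 0 < l ->
  {within `[0, l], continuous f} -> 0 <= p <= l -> 0 < e ->
  exists2 q, 0 < q < l & `|f p - f q| <= e.
Proof.
move=> l0 /(continuous_within_itvP _ l0)[_ f0 fl] /andP[p0 pl] e0.
have [p_eq0|pN0] := eqVneq p 0.
  move: f0 => /cvgrPdist_le /(_ _ e0) f0.
  near (0 : R)^'+ => q; exists q; last by rewrite p_eq0; near: q.
  by apply/andP; split; near: q; [exact: nbhs_right_gt|exact: nbhs_right_lt].
have [p_eql|pNl] := eqVneq p l.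
  move: fl => /cvgrPdist_le /(_ _ e0) fl.
  near l^'- => q; exists q; last by rewrite p_eql; near: q.
  by apply/andP; split; near: q; [exact: nbhs_left_gt|exact: nbhs_left_lt].
exists p; first by rewrite !lt_neqAle eq_sym pN0 p0 pNl.
by rewrite subrr normr0 ltW.
Unshelve. all: by end_near. Qed.

Lemma weak_derivative_osc_le (l : R) (f g : R -> R) (x y : R) : 0 < l ->
  {within `[0, l], continuous f} -> weak_derivative l f g ->
  0 <= x <= l -> 0 <= y <= l ->
  (`|f x - f y|%:E <= \int[mu]_(t in `[0%R, l]) `|g t|%:E)%E.
Proof.
move=> l0 cf wd xl yl.
wlog fyx : x y xl yl / f y <= f x.
  move=> H; have [?|?] := leP (f y) (f x); first exact: H.
  by rewrite distrC; apply: H => //; exact: ltW.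
rewrite ger0_norm ?subr_ge0// integral_itv_bndoo; last first.
  case: wd => _ [[mg _ _] _]; apply/measurable_EFinP.
  exact: measurableT_comp.
apply/lee_addgt0Pr => e e0.
have e20 : 0 < e / 2 by rewrite divr_gt0.
have [p pl fp] := interior_approx l0 cf xl e20.
have [q ql fq] := interior_approx l0 cf yl e20.
apply: (@le_trans _ _ ((f p - f q)%:E + e%:E)%E); last first.
  by rewrite leeD2r// weak_derivative_sub_le.
rewrite -EFinD lee_fin.
by move: fp fq; rewrite !ler_norml => /andP[? ?] /andP[? ?]; lra.
Qed.

End weak_oscillation.

(** * Zigzags of the honeycomb *)

Section esum_facts.
Context {R : realType}.
Local Open Scope ereal_scope.

Lemma esum_subset (T : choiceType) (A B : set T) (a : T -> \bar R) :
  A `<=` B -> \esum_(x in A) a x <= \esum_(x in B) a x.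
Proof.
move=> AB; apply: ge_ereal_sup => _ [X [finX XA] <-].
by apply: ereal_sup_ubound; exists X => //; split => //; exact: subset_trans AB.
Qed.

Lemma esum_mulr_le (T : choiceType) (A : set T) (c : \bar R) (a : T -> \bar R) :
  0 <= c -> (forall x, 0 <= a x) ->
  \esum_(x in A) (c * a x) <= c * \esum_(x in A) a x.
Proof.
move=> c0 a0; apply: ge_ereal_sup => _ [X [finX XA] <-].
rewrite -ge0_mule_fsumr// lee_wpmul2l//.
by apply: ereal_sup_ubound; exists X.
Qed.

(** The discrete Loomis-Whitney step: by injectivity the terms are distinct terms of the double sum
    over [I] and [J], which factors. *)
Lemma esum_mul_inj_le (T I J : choiceType) (f : T -> I) (g : T -> J)
    (a : I -> \bar R) (b : J -> \bar R) :
  injective (fun x => (f x, g x)) ->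
  (forall i, 0 <= a i) -> (forall j, 0 <= b j) ->
  \esum_(x in [set: T]) (a (f x) * b (g x)) <=
  (\esum_(i in [set: I]) a i) * (\esum_(j in [set: J]) b j).
Proof.
move=> injfg a0 b0; pose h x := (f x, g x).
have bij_h : set_bij [set: T] (h @` [set: T]) h.
  by apply: inj_bij => x y _ _; exact: injfg.
rewrite -(reindex_esum _ _ _ (fun z : I * J => a z.1 * b z.2) bij_h).
apply: (@le_trans _ _
  (\esum_(z in [set: I] `*`` (fun=> [set: J])) (a z.1 * b z.2))).
  by apply: esum_subset => z _; split.
rewrite -(@esum_esum _ _ _ _ _ (fun i j => a i * b j)); last first.
  by move=> i j _ _; rewrite mule_ge0.
apply: (@le_trans _ _
  (\esum_(i in [set: I]) ((\esum_(j in [set: J]) b j) * a i))).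
  apply: le_esum => i _; rewrite [leRHS]muleC; exact: esum_mulr_le.
by rewrite [leRHS]muleC; apply: esum_mulr_le => //; exact: esum_ge0.
Qed.

Lemma esum_fibers (T I : choiceType) (f : T -> I) (a : T -> \bar R) :
  (forall x, 0 <= a x) ->
  \esum_(i in [set: I]) \esum_(x in [set x | f x = i]) a x =
  \esum_(x in [set: T]) a x.
Proof.
move=> a0; rewrite esum_esum//.
apply: (@reindex_esum _ _ _ _ _ (fun x => (f x, x))
  (fun z : I * T => a z.2)); split.
- by move=> x _; split.
- by move=> x y _ _ [].
- by move=> [i x] [_ /= fx]; exists x => //; rewrite fx.
Qed.

Lemma sum_le_esum_range (T : choiceType) (r : nat -> T) (a : T -> \bar R) n :
  injective r -> (forall x, 0 <= a x) ->
  \sum_(0 <= i < n) a (r i) <= \esum_(x in range r) a x.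
Proof.
move=> injr a0.
have bij_r : set_bij [set: nat] (range r) r.
  by apply: inj_bij => i j _ _; exact: injr.
rewrite (reindex_esum _ _ _ _ bij_r) -nneseries_esumT//.
exact: nneseries_lim_ge.
Qed.

End esum_facts.

(** * Combinatorics of the zigzags *)

Section honeycomb_rays.

Lemma b_endE (e : edge) :
  b_end e =
  inr (e.1.1 - (e.2 == 1%N :> nat)%:Z, e.1.2 - (e.2 == 2%N :> nat)%:Z).
Proof. by case: e => [[m n] [[|[|[|//]]] i]]; rewrite /b_end/= ?subr0. Qed.

(* [line t] is constant along the zigzags made of the two types other than [t]
   and separates them. *)
Definition line (t : 'I_3) (e : edge) : int :=
  match val t with
  | 0%N => e.1.1 + e.1.2
  | 1%N => e.1.1
  | _ => e.1.2
  end.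

(** Any two of [m + n], [m] and [n] determine [(m, n)]. *)
Lemma line_inj (t t' : 'I_3) (k : 'I_3) : t != t' ->
  injective (fun p : int * int => (line t (p, k), line t' (p, k))).
Proof.
move=> tt' [m n] [m' n']; move: t t' tt'.
do 2![case=> [[|[|[|//]]] ?]] => //= _; rewrite /line/= => -[] ? ?;
  by congr pair; lia.
Qed.

(* The types alternate between [e.2] and [k]; the zigzag leaves [e] through its
   b-vertex. *)
Definition zigzag (e : edge) (k : 'I_3) (i : nat) : edge :=
  let s := (uphalf i)%:Z in
  ((e.1.1 + s * ((k == 1%N :> nat)%:Z - (e.2 == 1%N :> nat)%:Z),
    e.1.2 + s * ((k == 2%N :> nat)%:Z - (e.2 == 2%N :> nat)%:Z)),
   if odd i then k else e.2).

Lemma zigzag0 (e : edge) (k : 'I_3) : zigzag e k 0 = e.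
Proof. by case: e => [[m n] j]; rewrite /zigzag/= !mul0r !addr0. Qed.

(** Passing from an even index to the next moves the a-vertex by the difference of the offsets of
    the types [k] and [e.2], which is what the change of type takes away again in [b_endE]. Passing
    from an odd index leaves [uphalf], hence the a-vertex, unchanged. *)
Lemma zigzag_b_end (e : edge) (k : 'I_3) (i : nat) : ~~ odd i ->
  b_end (zigzag e k i) = b_end (zigzag e k i.+1).
Proof.
move=> oi; rewrite !b_endE /zigzag /= oi (negbTE oi) uphalf_half (negbTE oi) add0n.
by congr (inr (_, _)); rewrite -[(i./2).+1]addn1 PoszD mulrDl mul1r; lia.
Qed.

Lemma zigzag_a_end (e : edge) (k : 'I_3) (i : nat) : odd i ->
  a_end (zigzag e k i) = a_end (zigzag e k i.+1).
Proof. by move=> oi; rewrite /a_end /zigzag /= uphalf_half oi. Qed.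

(** The type of an edge reveals the parity of its index, and its position reveals [uphalf], because
    distinct types give a nonzero displacement. *)
Lemma zigzag_inj (e : edge) (k : 'I_3) : k != e.2 -> injective (zigzag e k).
Proof.
case: e => [[m n] j] /= kj a b; rewrite /zigzag/= => -[+ +].
move=> /addrI E1 /addrI E2 E3.
have odd_eq : odd a = odd b.
  by move: E3 kj; case: (odd a) (odd b) => -[]// ->; rewrite eqxx.
have half_eq : uphalf a = uphalf b.
  by move: j k kj E1 E2 {E3}; do 2![case=> [[|[|[|//]]] ?]] => //= _; lia.
move: half_eq; rewrite !uphalf_half odd_eq => /addnI h.
by rewrite -(odd_double_half a) -(odd_double_half b) odd_eq h.
Qed.

(** The displacement of the zigzag has coordinate 0 along [line t] when [t] is the third type: for
    instance it is [(1, -1)] or its opposite for [t = 0], where [line] is [m + n]. *)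
Lemma line_zigzag (t : 'I_3) (e : edge) (k : 'I_3) (i : nat) :
  t != e.2 -> t != k -> k != e.2 -> line t (zigzag e k i) = line t e.
Proof.
case: e => [[m n] j] /=; move: t j k.
do 3![case=> [[|[|[|//]]] ?]] => //= _ _ _; rewrite /line /zigzag/=; lia.
Qed.

Lemma third_type (t j : 'I_3) : t != j -> exists2 k : 'I_3, t != k & k != j.
Proof.
move=> tj; have : (0 < #|~: [set t; j]|)%N.
  by rewrite cardsCs finset.setCK card_ord cards2 tj.
move=> /card_gt0P[k]; rewrite !inE negb_or => /andP[kt kj].
by exists k => //; rewrite eq_sym.
Qed.

End honeycomb_rays.

(** * Pointwise bounds along a zigzag *)

Section ray_estimate.
Context {R : realType} (l : R) (l0 : 0 < l).
(** To be instantiated with [w] the real or imaginary part of [u], [wv] its vertex values, and [E],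
    [F] the edgewise L^1 norms of the weak derivative and of [u]. *)
Variables (w : edge -> R -> R) (wv : vertex -> R) (E F : edge -> \bar R).
Hypothesis w0 : forall e, w e 0 = wv (a_end e).
Hypothesis wl : forall e, w e l = wv (b_end e).
Hypothesis wE : forall e x y, 0 <= x <= l -> 0 <= y <= l ->
  (`|w e x - w e y|%:E <= E e)%E.
Hypothesis F0 : forall e, (0 <= F e)%E.
Hypothesis wF : forall e d, 0 <= d -> (forall x, 0 <= x <= l -> d <= `|w e x|) ->
  ((d * l)%:E <= F e)%E.
Hypothesis Ffin : (\esum_(e in [set: edge]) F e < +oo)%E.

Let E0 e : (0 <= E e)%E.
Proof.
have l00 : 0 <= (0 : R) <= l by rewrite lexx ltW.
by apply: le_trans (wE e l00 l00); rewrite lee_fin.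
Qed.

Lemma zigzag_osc_le e k n x y : 0 <= x <= l -> 0 <= y <= l ->
  (`|w e x - w (zigzag e k n) y|%:E <= \sum_(0 <= i < n.+1) E (zigzag e k i))%E.
Proof.
move=> xl; elim: n y => [|n IH] y yl.
  by rewrite big_nat1 zigzag0; exact: wE.
(* Consecutive edges meet alternately at a b-vertex, coordinate [l], and at an a-vertex, coordinate
   0. *)
have [s sl ws] : exists2 s, 0 <= s <= l &
      w (zigzag e k n) s = w (zigzag e k n.+1) s.
  have [on|on] := boolP (odd n).
    by exists 0; rewrite ?lexx ?ltW// !w0 zigzag_a_end.
  by exists l; rewrite ?lexx ?ltW// !wl zigzag_b_end.
rewrite big_nat_recr//=.
apply: (@le_trans _ _ (`|w e x - w (zigzag e k n) s|%:E +
    `|w (zigzag e k n.+1) s - w (zigzag e k n.+1) y|%:E)%E).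
  by rewrite -EFinD lee_fin -ws (le_trans _ (ler_normD _ _))// addrA subrK.
by apply: leeD; [exact: IH|exact: wE].
Qed.

(* Integrability forces [w] to come arbitrarily close to 0 along the zigzag. *)
Lemma zigzag_sup_le e k x : k != e.2 -> 0 <= x <= l ->
  (`|w e x|%:E <= \esum_(e' in range (zigzag e k)) E e')%E.
Proof.
move=> kj xl; set T := esum _ _.
have T0 : (0 <= T)%E by exact: esum_ge0.
have [->|] := eqVneq T +oo%E; first by rewrite leey.
rewrite -ltey => Tfin.
have TE : T = (fine T)%:E by rewrite fineK// ge0_fin_numE.
(* If [|w e x|] exceeded the total oscillation [T] by [d > 0], then [|w| >= d] on the whole zigzag,
   and each of its edges would contribute at least [d * l] to the finite sum of [F]. *)
rewrite leNgt; apply/negP; rewrite TE lte_fin -subr_gt0; set d := _ - _ => d0.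
have Fd n : ((d * l)%:E <= F (zigzag e k n))%E.
  apply: wF; first exact: ltW.
  move=> y yl; have := le_trans (zigzag_osc_le e k n xl yl)
    (sum_le_esum_range n.+1 (zigzag_inj kj) E0).
  rewrite -/T TE lee_fin /d => h.
  by rewrite lerBlDr -lerBlDl (le_trans _ h)// lerB_dist.
have SF := esum_subset F (@subsetT _ (range (zigzag e k))).
have := le_lt_trans SF Ffin.
set S := esum _ _ => Sfin.
have S0 : (0 <= S)%E by exact: esum_ge0.
have SE : S = (fine S)%:E by rewrite fineK// ge0_fin_numE.
have dl0 : 0 < d * l by rewrite mulr_gt0.
pose n := Num.bound (fine S / (d * l)).
have Sdl0 : 0 <= fine S / (d * l) by rewrite divr_ge0 ?fine_ge0// ltW.
have : fine S / (d * l) < n%:R by exact: archi_boundP.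
rewrite ltr_pdivrMr// => /lt_geF/negP; apply.
rewrite -lee_fin -SE.
apply: (le_trans _ (sum_le_esum_range n (zigzag_inj kj) F0)).
rewrite mulr_natl -[n in leLHS]subn0 -sumr_const_nat -sumEFin.
by apply: lee_sum => i _; exact: Fd.
Qed.

(** The ray leaving [e] is enlarged to a full level set of [line t], so that the bound depends on
    [e] only through [line t e]. *)
Lemma line_sup_le t e x : t != e.2 -> 0 <= x <= l ->
  (`|w e x|%:E <= \esum_(e' in [set e' | line t e' = line t e]) E e')%E.
Proof.
move=> te xl; have [k tk ke] := third_type te.
apply: (le_trans (zigzag_sup_le ke xl)).
by apply: esum_subset => _ [i _ <-] /=; exact: line_zigzag.
Qed.

End ray_estimate.

(** * The inequality *)

Section complex_norm.
Context {R : realType}.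
Local Notation normc := (@ComplexField.Normc.normc R).

Lemma normcE (z : R[i]) :
  normc z = Num.sqrt (complex.Re z ^+ 2 + complex.Im z ^+ 2).
Proof. by case: z. Qed.

Lemma sqr_normc (z : R[i]) :
  normc z ^+ 2 = complex.Re z ^+ 2 + complex.Im z ^+ 2.
Proof. by rewrite normcE sqr_sqrtr// addr_ge0// sqr_ge0. Qed.

Lemma normc_ge0 (z : R[i]) : 0 <= normc z.
Proof. by rewrite normcE sqrtr_ge0. Qed.

Lemma Re_le_normc (z : R[i]) : `|complex.Re z| <= normc z.
Proof. by rewrite normcE -sqrtr_sqr ler_wsqrtr// lerDl sqr_ge0. Qed.

Lemma Im_le_normc (z : R[i]) : `|complex.Im z| <= normc z.
Proof. by rewrite normcE -sqrtr_sqr ler_wsqrtr// lerDr sqr_ge0. Qed.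

Lemma measurable_normc (D : set R) (f : R -> R[i]) :
  measurable_fun D (re f) -> measurable_fun D (im f) ->
  measurable_fun D (normc \o f).
Proof.
move=> mre mim.
have -> : normc \o f = (@Num.sqrt R) \o (fun x => re f x ^+ 2 + im f x ^+ 2).
  by apply/funext => x /=; rewrite normcE.
apply: measurableT_comp.
  by apply: continuous_measurable_fun; exact: sqrt_continuous.
by apply: measurable_funD; exact: measurable_funX.
Qed.

End complex_norm.

(** * Bounds on the real and imaginary parts of [u] *)

Section edge_bounds.
Context {R : realType} (l : R) (l0 : 0 < l).
Local Notation mu := (@lebesgue_measure R).
Local Notation normc := (@ComplexField.Normc.normc R).

Lemma integral_cst_segment (c : R) :
  (\int[mu]_(x in `[0%R, l]) c%:E = (c * l)%:E)%E.
Proof.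
by rewrite integral_cst//= lebesgue_measure_itv/= lte_fin l0 sube0 EFinM.
Qed.

(** The exponent 1 is kept so that this is literally the summand of [normG l 1]. *)
Definition edge_norm1 (u : gfun R) (e : edge) : \bar R :=
  (\int[mu]_(x in `[0%R, l]) (normc (u e x) `^ 1)%:E)%E.

Lemma edge_norm1_ge0 u e : (0 <= edge_norm1 u e)%E.
Proof. by apply: integral_ge0 => x _; rewrite lee_fin powR_ge0. Qed.

Lemma edge_norm1E u e :
  edge_norm1 u e = (\int[mu]_(x in `[0%R, l]) (normc (u e x))%:E)%E.
Proof. by apply: eq_integral => x _; rewrite powRr1// normc_ge0. Qed.

Lemma normG1E u : normG l 1 u = (\esum_(e in [set: edge]) edge_norm1 u e)%E.
Proof.
rewrite /normG invr1 poweRe1//.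
by apply: esum_ge0 => e _; exact: edge_norm1_ge0.
Qed.

Lemma weak_derivative_measurable (f g : R -> R) :
  weak_derivative l f g -> measurable_fun `[0, l] g.
Proof. by move=> [_ [[mg _ _] _]]; exact: measurable_fun_itv_cc mg. Qed.

(** Here [c] is the real or the imaginary part, so that one argument serves both. *)
Lemma component_line_le (c : R[i] -> R) (u v : gfun R) (t : 'I_3) e x :
  (forall z, `|c z| <= normc z) ->
  (forall e, {within `[0, l], continuous (c \o u e)}) ->
  (forall e, weak_derivative l (c \o u e) (c \o v e)) ->
  continuousG l u -> memLqG l 1 u -> weak_derivativeG l u v ->
  t != e.2 -> 0 <= x <= l ->
  (`|c (u e x)|%:E <=
     \esum_(e' in [set e' | line t e' = line t e]) edge_norm1 v e')%E.
Proof.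
move=> c_le cc cwd [_ [w uw]] [mu_ ufin] uv te xl.
apply: (@line_sup_le R l l0 (fun e => c \o u e) (c \o w) (edge_norm1 v)
  (edge_norm1 u)) => //.
- by move=> e' /=; rewrite (uw e').1.
- by move=> e' /=; rewrite (uw e').2.
- move=> e' y z yl zl.
  apply: (le_trans (weak_derivative_osc_le l0 (cc e') (cwd e') yl zl)).
  have [wre wim] := uv e'.
  rewrite edge_norm1E; apply: ge0_le_integral => //.
  + apply/measurable_EFinP; have mcv := weak_derivative_measurable (cwd e').
    exact: measurableT_comp mcv.
  + apply/measurable_EFinP; apply: measurable_normc.
      exact: weak_derivative_measurable wre.
    exact: weak_derivative_measurable wim.
  + by move=> s _; rewrite lee_fin c_le.
- by move=> e'; exact: edge_norm1_ge0.
- move=> e' d d0 d_le; rewrite -integral_cst_segment edge_norm1E.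
  apply: ge0_le_integral => //.
  + by apply/measurable_EFinP; have [? ?] := mu_ e'; exact: measurable_normc.
  + move=> s; rewrite /= in_itv/= => sl.
    by rewrite lee_fin (le_trans (d_le s sl))// c_le.
- by rewrite -normG1E.
Qed.

End edge_bounds.

(** * Summation over the three edge types *)

Section sum_over_types.
Context {R : realType}.
Local Open Scope ereal_scope.

Lemma esum_edge (a : edge -> \bar R) : (forall e, 0 <= a e) ->
  \esum_(e in [set: edge]) a e =
  \sum_(k < 3) \esum_(p in [set: int * int]) a (p, k).
Proof.
move=> a0; rewrite -(esum_fibers (fun e : edge => e.2))//.
rewrite esum_fset; [|exact: finite_finset|by move=> k _; exact: esum_ge0].
have -> : [set: 'I_3] = [set` index_enum 'I_3].
  by apply/seteqP; split => k //= _; exact: mem_index_enum.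
rewrite -fsbig_seq ?index_enum_uniq//; apply: eq_bigr => k _.
apply: (@reindex_esum _ _ _ _ _ (fun p => (p, k) : edge)); split => //.
- by move=> p q _ _ [].
- by move=> [p k'] /= <-; exists p.
Qed.

(** The level set contains the zigzag and also the edges of type [t] attached at its a-vertices.
    Thus for fixed [t] the level sets partition all edges, and the line sums add up to the full
    sum. *)
Definition line_sum (E : edge -> \bar R) (t : 'I_3) (i : int) : \bar R :=
  \esum_(e in [set e | line t e = i]) E e.

Lemma line_sum_ge0 (E : edge -> \bar R) t i :
  (forall e, 0 <= E e) -> 0 <= line_sum E t i.
Proof. by move=> E0; exact: esum_ge0. Qed.

(** Within one type [k] the two lines determine the edge, so the sum of products is at most the
    product of the sums over all lines, each of which is the full sum of [E]. *)
Lemma esum_line_mul_le (E : edge -> \bar R) (s1 s2 : 'I_3 -> 'I_3) :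
  (forall k, s1 k != s2 k) -> (forall e, 0 <= E e) ->
  \esum_(e in [set: edge])
    (line_sum E (s1 e.2) (line (s1 e.2) e) *
     line_sum E (s2 e.2) (line (s2 e.2) e)) <=
  \sum_(k < 3) (\esum_(e in [set: edge]) E e) * (\esum_(e in [set: edge]) E e).
Proof.
move=> s12 E0.
have T0 t i : 0 <= line_sum E t i by exact: line_sum_ge0.
rewrite esum_edge; last by move=> e; rewrite mule_ge0.
apply: lee_sum => k _ /=.
apply: (le_trans (esum_mul_inj_le (line_inj (k := k) (s12 k))
  (T0 (s1 k)) (T0 (s2 k)))).
by rewrite /line_sum !esum_fibers.
Qed.

End sum_over_types.

Theorem theorem3p1 (R : realType) (l : R) (hl : 0 < l) (u v : gfun R)
  (hu : W11G l u) (hv : weak_derivativeG l u v) :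
  (normG l 2 u <= (2 * Num.sqrt (2 * l))%:E * normG l 1 v)%E.
Proof.
have [cu [mu _]] := hu.
pose E := edge_norm1 l v.
have E0 e : (0 <= E e)%E by exact: edge_norm1_ge0.
pose A := (\esum_(e in [set: edge]) E e)%E.
have A0 : (0 <= A)%E by exact: esum_ge0.
rewrite normG1E -/A.
have c0 : 0 < 2 * Num.sqrt (2 * l) by rewrite mulr_gt0// sqrtr_gt0 mulr_gt0.
(* The norm of [v] may a priori be infinite; the right-hand side is then [+oo], its constant being
   positive. *)
have [->|] := eqVneq A +oo%E; first by rewrite gt0_muley ?lte_fin// leey.
rewrite -ltey => Afin.
pose T := line_sum E.
have T0 t i : (0 <= T t i)%E by exact: line_sum_ge0.
have TE t i : T t i = (fine (T t i))%:E.
  rewrite fineK// ge0_fin_numE//; apply: le_lt_trans Afin; exact: esum_subset.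
(* Modulo 3 these are [k + 1] and [k - 1], the two types other than [k]: they index the two zigzag
   families through an edge of type [k]. *)
pose s1 (k : 'I_3) : 'I_3 := ordS k.
pose s2 (k : 'I_3) : 'I_3 := ord_pred k.
have s1N k : s1 k != k by case: k => [[|[|[|//]]] ?].
have s2N k : s2 k != k by case: k => [[|[|[|//]]] ?].
have s12 k : s1 k != s2 k by case: k => [[|[|[|//]]] ?].
have re_le t e x : t != e.2 -> 0 <= x <= l ->
    `|re (u e) x| <= fine (T t (line t e)).
  move=> te xl; rewrite -lee_fin -TE.
  apply: (component_line_le hl _ _ _ cu mu hv te xl) => [z|e'|e'].
  - exact: Re_le_normc.
  - exact: (cu.1 e').1.
  - exact: (hv e').1.
have im_le t e x : t != e.2 -> 0 <= x <= l ->
    `|im (u e) x| <= fine (T t (line t e)).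
  move=> te xl; rewrite -lee_fin -TE.
  apply: (component_line_le hl _ _ _ cu mu hv te xl) => [z|e'|e'].
  - exact: Im_le_normc.
  - exact: (cu.1 e').2.
  - exact: (hv e').2.
have edge_le e : (\int[@lebesgue_measure R]_(x in `[0%R, l])
    (ComplexField.Normc.normc (u e x) `^ 2)%:E <=
    (2 * l)%:E *
    (T (s1 e.2) (line (s1 e.2) e) * T (s2 e.2) (line (s2 e.2) e)))%E.
  rewrite TE [T (s2 _) _]TE -!EFinM mulrAC -integral_cst_segment//.
  apply: ge0_le_integral => //.
  - by move=> x _; rewrite lee_fin powR_ge0.
  - apply/measurable_EFinP.
    have [mre mim] := mu.1 e.
    exact: measurableT_comp (measurable_powR 2) (measurable_normc mre mim).
  - move=> x; rewrite /= in_itv/= => xl.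
    rewrite lee_fin (powR_mulrn 2) ?normc_ge0// sqr_normc mulr2n mulrDl !mul1r.
    rewrite -[complex.Re _ ^+ 2]real_normK ?num_real//.
    rewrite -[complex.Im _ ^+ 2]real_normK ?num_real//.
    (* In each square one factor is bounded along the first zigzag and the other along the second;
       the two squares account for the 2 in [2 * l]. *)
    by rewrite !expr2 lerD// ler_pM// ?re_le ?im_le.
have l20 : 0 <= 2 * l by rewrite mulr_ge0// ltW.
have sum_le : (\esum_(e in [set: edge])
    \int[@lebesgue_measure R]_(x in `[0%R, l])
    (ComplexField.Normc.normc (u e x) `^ 2)%:E <=
    (2 * l * (3 * fine A ^+ 2))%:E)%E.
  apply: (le_trans (le_esum (fun e _ => edge_le e))).
  apply: (le_trans (esum_mulr_le _ _ _)).
  - exact: l20.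
  - by move=> e; rewrite mule_ge0.
  rewrite [leRHS]EFinM; apply: lee_wpmul2l; first exact: l20.
  apply: (le_trans (esum_line_mul_le s12 E0)); rewrite -/A.
  have -> : A = (fine A)%:E by rewrite fineK// ge0_fin_numE.
  by rewrite !big_ord_recl big_ord0 -!EFinM -!EFinD lee_fin /=; lra.
have AE : A = (fine A)%:E by rewrite fineK// ge0_fin_numE.
have a0 : 0 <= fine A by rewrite fine_ge0.
have l6 : 0 <= 2 * l * (3 * fine A ^+ 2).
  by rewrite mulr_ge0// mulr_ge0// sqr_ge0.
rewrite /normG.
apply: (@le_trans _ _ ((2 * l * (3 * fine A ^+ 2))%:E `^ 2^-1)%E).
  apply: gt0_ler_poweR; [by rewrite invr_ge0| | |exact: sum_le].
  - rewrite in_itv/= leey andbT; apply: esum_ge0 => e _.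
    by apply: integral_ge0 => x _; rewrite lee_fin powR_ge0.
  - by rewrite in_itv/= leey andbT lee_fin.
rewrite [in leRHS]AE poweR_EFin powR12_sqrt// -EFinM lee_fin.
(* After squaring, with [a = fine A], the claim reads [6 l a^2 <= 8 l a^2]. *)
rewrite -(@ler_pXn2r _ 2) ?nnegrE ?sqrtr_ge0 ?mulr_ge0 ?sqrtr_ge0//.
rewrite sqr_sqrtr// !exprMn sqr_sqrtr//.
by have := mulr_ge0 (ltW hl) (sqr_ge0 (fine A)); nra.
Qed.
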